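(* Let $w\in\widetilde W$ be $\mu$-admissible, let $J\subseteq\Phi$ be a root subsystem, let $s\in T(k_r)$, and let $\gamma_{N_rs}\in X^*(\widehat T)$ be a character with $\gamma_{N_rs}(\kappa_\chi)=\chi(N_r(s))$ for all $\chi\in T(k_F)^\vee$. Then $$\sum_{\kappa_\chi\in S_{w,J}^{\mathrm{dz}}}\gamma_{N_rs}(\kappa_\chi)^{-1}=\begin{cases}0,&\text{if }N_r(s)\notin A_{w,J,k_F},\\ |S_{w,J}^{\mathrm{dz}}|,&\text{otherwise.}\end{cases}$$
   Context: $F$ is a non-archimedean local field with ring of integers $\mathcal O_F$ and residue field $k_F$ of cardinality $q$; $F_r/F$ is the degree $r$ unramified extension, $k_r$ its residue field. $G$ is a split connected reductive group over $F$ with connected center and simply connected derived group, $T$ a split maximal torus (in a Borel $B$), $\Phi=\Phi(G,T)$, $W$ the Weyl group, $\widehat T$ the dual torus over $\mathbb C$, $X^*(\widehat T)=X_*(T)$; $W$ acts on $\widehat T(\mathbb C)$ with $(\bar w\nu)(\kappa)=\nu(\bar w^{-1}\kappa)$. $N_r:T(k_r)\to T(k_F)$ is the norm map. $\widetilde W=X_*(T)\rtimes W$, with its Bruhat order $\le$ determined by the base alcove in the $B$-positive chamber; $\mu\in X_*(T)$ is dominant and minuscule, and $w\in\widetilde W$ is $\mu$-admissible if $w\le t_\eta$ for some $\eta\in W\mu$. Write $w=t_\lambda\bar w$ with $\lambda\in X_*(T)$, $\bar w\in W$. $T(k_F)^\vee$ is the group of depth-zero characters $\chi:T(\mathcal O_F)\to\mathbb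 C^\times$ (those factoring through $T(k_F)$; also viewed as characters of $T(k_F)$). Fix $x$ in the inertia group $I_F$ whose image $\tau_F(x)\in\mathcal O_F^\times$ under the reciprocity map projects to a generator of $k_F^\times$; the endoscopic element $\kappa_\chi\in\widehat T(\mathbb C)$ is the element with $\nu(\kappa_\chi)=\chi(\nu(\tau_F(x)))$ for all $\nu\in X^*(\widehat T)=X_*(T)$. A root subsystem $J\subseteq\Phi$ is a subset with $s_\alpha(J)=J$ for all $\alpha\in J$. $S_w=\{\kappa\in\widehat T(\mathbb C):\bar w\kappa=\kappa,\ \lambda(\kappa)=1\}$; $S_{w,J}=S_w\cap\bigcap_{\alpha\in J}\ker(\alpha^\vee)$ with $\alpha^\vee$ viewed as a character of $\widehat T$; $S_{w,J}^{\mathrm{dz}}$ is the (finite) subset of elements of $S_{w,J}$ of the form $\kappa_\chi$ with $\chi\in T(k_F)^\vee$. $L_{w,J}\subset X_*(T)$ is the subgroup generated by $\lambda+\bar w(\nu)-\nu$ ($\nu\in X_*(T)$) and $\alpha^\vee$ ($\alpha\in J$). The finite critical group is $A_{w,J,k_F}=\langle\nu(k_F^\times):\nu\in L_{w,J}\rangle\subset T(k_F)$. *)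

(* Defs.v *)
From HB Require Import structures.
From mathcomp Require Import all_boot all_order all_algebra.
From mathcomp Require Import vector falgebra fieldext galois finfield.
From mathcomp Require Import finmap.
From mathcomp Require Import complex.
From mathcomp Require Import mathcomp_extra boolp classical_sets functions.
From mathcomp Require Import cardinality fsbigop reals topology.

Set Implicit Arguments.
Unset Strict Implicit.
Unset Printing Implicit Defensive.

Import Order.TTheory GRing.Theory Num.Theory.
Import numFieldTopology.Exports.

Local Open Scope classical_set_scope.
Local Open Scope ring_scope.

Inductive zspan (V : zmodType) (P : set V) : set V :=
| zspan0 : zspan P 0
| zspan_mem x : P x -> zspan P x
| zspanB x y : zspan P x -> zspan P y -> zspan P (x - y).

Inductive gspan (G : groupType) (P : set G) : set G :=
| gspan1 : gspan P 1%g
| gspan_mem x : P x -> gspan P x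
| gspan_div x y : gspan P x -> gspan P y -> gspan P (x * y^-1)%g.

Section Units.
Variable A : comUnitRingType.

Record units := Units { uval :> A; _ : uval \is a GRing.unit }.

HB.instance Definition _ := [isSub for uval].
HB.instance Definition _ := [Choice of units by <:].

Lemma uvalP (x : units) : uval x \is a GRing.unit. Proof. exact: valP. Qed.

Lemma units_mulP (x y : units) : uval x * uval y \is a GRing.unit.
Proof. by rewrite unitrM !uvalP. Qed.
Lemma units_invP (x : units) : (uval x)^-1 \is a GRing.unit.
Proof. by rewrite unitrV uvalP. Qed.

Definition units_one := Units (unitr1 A).
Definition units_mul x y := Units (units_mulP x y).
Definition units_inv x := Units (units_invP x).

Lemma units_mulA : associative units_mul.
Proof. by move=> x y z; apply/val_inj; rewrite /= mulrA. Qed.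
Lemma units_mul1g : left_id units_one units_mul.
Proof. by move=> x; apply/val_inj; rewrite /= mul1r. Qed.
Lemma units_mulg1 : right_id units_one units_mul.
Proof. by move=> x; apply/val_inj; rewrite /= mulr1. Qed.
Lemma units_mulVg : left_inverse units_one units_inv units_mul.
Proof. by move=> x; apply/val_inj; rewrite /= mulVr ?uvalP. Qed.
Lemma units_mulgV : right_inverse units_one units_inv units_mul.
Proof. by move=> x; apply/val_inj; rewrite /= divrr ?uvalP. Qed.

HB.instance Definition _ := isGroup.Build units
  units_mulA units_mul1g units_mulg1 units_mulVg units_mulgV.

Lemma units_expP (x : units) (m : int) : uval x ^ m \is a GRing.unit.
Proof. by rewrite unitrXz ?uvalP. Qed.
Definition uexpz (x : units) (m : int) : units := Units (units_expP x m).

Lemma units_prodP n (t : 'I_n -> units) :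
  \prod_(i < n) uval (t i) \is a GRing.unit.
Proof. by rewrite unitr_prod // => i _; exact: uvalP. Qed.
Definition uprod n (t : 'I_n -> units) : units := Units (units_prodP t).

End Units.

Section UnitsMap.
Variables (A B : comUnitRingType) (f : {rmorphism A -> B}).

Lemma units_mapP (x : units A) : f (uval x) \is a GRing.unit.
Proof. exact/rmorph_unit/uvalP. Qed.
Definition units_map (x : units A) : units B := Units (units_mapP x).
End UnitsMap.

(* The split torus T is identified with G_m^n, so that X^*(T) is the lattice
   of rows 'rV[int]_n, X_*(T) the lattice of columns 'cV[int]_n, and the
   perfect pairing between them is the matrix product.  The dual torus has
   character lattice X_*(T), hence is again G_m^n, with columns as
   characters. *)

Definition torus (n : nat) (A : comUnitRingType) := {ffun 'I_n -> units A}.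

HB.instance Definition _ n A := Group.on (torus n A).

Definition pairing n (xi : 'rV[int]_n) (nu : 'cV[int]_n) : int :=
  (xi *m nu) 0 0.

Definition cochar n A (nu : 'cV[int]_n) (a : units A) : torus n A :=
  [ffun i => uexpz a (nu i 0)].

Definition dual_char n A (nu : 'cV[int]_n) (kappa : torus n A) : units A :=
  uprod (fun i => uexpz (kappa i) (nu i 0)).

Definition torus_map n A B (f : units A -> units B) (t : torus n A) :
  torus n B := [ffun i => f (t i)].

(* The value at 0 is irrelevant. *)
Record discreteValuation (F : fieldType) := DiscreteValuation {
  valuation :> F -> int;
  valuationM : forall x y, x != 0 -> y != 0 ->
    valuation (x * y) = valuation x + valuation y;
  valuationD : forall x y, x != 0 -> y != 0 -> x + y != 0 ->
    Num.min (valuation x) (valuation y) <= valuation (x + y);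
  valuation_normalized : exists2 pi, pi != 0 & valuation pi = 1 }.

Section Valuation.
Variables (F : fieldType) (v : discreteValuation F).

Definition val_ge (N : int) (x : F) : bool := (x == 0) || (N <= v x).

Definition val_complete : Prop := forall u : nat -> F,
  (forall N : int, exists m, forall i j,
     (m <= i)%N -> (m <= j)%N -> val_ge N (u i - u j)) ->
  exists l, forall N : int, exists m, forall i,
     (m <= i)%N -> val_ge N (u i - l).

Lemma valuation1 : v 1 = 0.
Proof.
have := valuationM v (oner_neq0 F) (oner_neq0 F).
by rewrite mulr1 => /esym/(canRL (addrK _)); rewrite subrr.
Qed.

Lemma valuationN x : x != 0 -> v (- x) = v x.
Proof.
move=> x0; have N1 : (-1 : F) != 0 by rewrite oppr_eq0 oner_neq0.
have := valuationM v N1 N1; rewrite mulrNN mulr1 valuation1 -mulr2n => /esym/eqP.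
rewrite mulrn_eq0 /= => /eqP v1.
by rewrite -mulN1r valuationM // v1 add0r.
Qed.

Lemma valuationV x : x != 0 -> v x^-1 = - v x.
Proof.
move=> x0; have := valuationM v x0 (invr_neq0 x0).
by rewrite divff // valuation1 => /esym/eqP; rewrite addr_eq0 => /eqP ->; rewrite opprK.
Qed.

Definition valring_pred : {pred F} := val_ge 0.

Lemma valring_predE x : (x \in valring_pred) = (x == 0) || (0 <= v x).
Proof. by []. Qed.

Lemma valring_closed : subring_closed valring_pred.
Proof.
split=> [|x y|x y]; rewrite !valring_predE.
- by rewrite valuation1 lexx orbT.
- have [-> _|x0 /= vx] := eqVneq x 0.
    by rewrite sub0r oppr_eq0; case: eqVneq => //= y0 vy; rewrite valuationN.
  have [->|y0 /= vy] := eqVneq y 0; first by rewrite subr0 vx orbT.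
  have [//|xy0 /=] := eqVneq (x - y) 0.
  have yN0 : - y != 0 by rewrite oppr_eq0.
  apply: le_trans (valuationD v x0 yN0 xy0).
  by rewrite le_min vx valuationN.
- rewrite mulf_eq0; case: eqVneq => //= x0 vx; case: eqVneq => //= y0 vy.
  by rewrite valuationM // addr_ge0.
Qed.

HB.instance Definition _ := GRing.isSubringClosed.Build F valring_pred
  valring_closed.

Record valring := ValRing { valring_val :> F; _ : valring_pred valring_val }.

HB.instance Definition _ := [isSub for valring_val].
HB.instance Definition _ := [Choice of valring by <:].
HB.instance Definition _ := [SubChoice_isSubComNzRing of valring by <:].

Definition valring_unit : {pred valring} :=
  fun x => (val x != 0) && (v (val x) == 0).

Lemma valring_inv_subproof (x : valring) :
  valring_pred (if x \in valring_unit then (val x)^-1 else val x).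
Proof.
rewrite unfold_in; case: ifP => [/andP[x0 /eqP vx]|_]; last exact: (valP x).
by rewrite /valring_pred /val_ge valuationV // vx oppr0 lexx orbT.
Qed.

Definition valring_inv (x : valring) : valring :=
  ValRing (valring_inv_subproof x).

Lemma valring_mulVx : {in valring_unit, left_inverse 1 valring_inv *%R}.
Proof.
move=> x ux; apply/val_inj; rewrite /= ux.
by move: ux; rewrite unfold_in => /andP[x0 _]; rewrite mulVf.
Qed.

Lemma valring_unitPl (x y : valring) : y * x = 1 -> valring_unit x.
Proof.
move=> /(congr1 val) /= yx; rewrite /valring_unit.
have : val y * val x != 0 by rewrite yx oner_neq0.
rewrite mulf_eq0 negb_or => /andP[y0 x0]; rewrite x0 /=.
have := valuationM v y0 x0; rewrite yx valuation1.
move: (valP x) (valP y); rewrite /= /valring_pred /val_ge (negPf x0) (negPf y0) /=.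
move=> vx vy /esym/eqP; rewrite paddr_eq0 // => /andP[] //.
Qed.

Lemma valring_inv_out : {in [predC valring_unit], valring_inv =1 id}.
Proof. by move=> x; rewrite inE /= => nx; apply/val_inj; rewrite /= (negPf nx). Qed.

HB.instance Definition _ := GRing.ComNzRing_hasMulInverse.Build valring
  valring_mulVx valring_unitPl valring_inv_out.

(* k is a residue field of O = valring via red: red is onto and its kernel is
   the maximal ideal of O. *)
Record residueMap (k : fieldType) := ResidueMap {
  red :> {rmorphism valring -> k};
  red_surj : forall a, exists x, red x = a;
  red_ker : forall x, (red x == 0) = (x \isn't a GRing.unit) }.

End Valuation.

Record localField := LocalField {
  lf_sort :> fieldType;
  lf_val : discreteValuation lf_sort;
  lf_complete : val_complete lf_val;
  lf_res : finFieldType;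
  lf_red : residueMap lf_val lf_res }.

Definition lf_int (F : localField) := valring (lf_val F).
HB.instance Definition _ F := GRing.ComUnitRing.on (lf_int F).

(* The condition ur_valE, where both valuations are normalized, says that the
   ramification index is 1; residue extensions are automatically separable. *)
Record unramifiedExt (F : localField) (r : nat) := UnramifiedExt {
  ur_sort :> fieldExtType F;
  ur_dim : \dim {:ur_sort} = r;
  ur_val : discreteValuation ur_sort;
  ur_valE : forall a : F, a != 0 -> ur_val a%:A = lf_val F a;
  ur_res : splittingFieldType (lf_res F);
  ur_red : residueMap ur_val ur_res;
  ur_redE : forall (a : lf_int F) (b : valring ur_val),
    val b = (val a)%:A -> ur_red b = (lf_red F a)%:A }.

Section Norm.
Variables (k : finFieldType) (L : splittingFieldType k).

Lemma res_norm_subproof (a : L) :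
  exists b : k, b%:A == galNorm 1%AS {:L}%AS a.
Proof.
have /galois_fixedField H := finField_galois (sub1v {:L}%AS).
have := galNorm_fixedField 1%AS (memvf a); rewrite H.
by move=> /vlineP[b ->]; exists b.
Qed.

Definition res_norm (a : L) : k := xchoose (res_norm_subproof a).

Lemma res_normE (a : L) : (res_norm a)%:A = galNorm 1%AS {:L}%AS a.
Proof. exact/eqP/(xchooseP (res_norm_subproof a)). Qed.

Lemma res_norm_unit (a : units L) : res_norm (uval a) \is a GRing.unit.
Proof.
rewrite unitfE; apply: contraTneq (uvalP a) => N0.
move: (res_normE (uval a)); rewrite N0 scale0r => /esym/eqP.
by rewrite galNorm_eq0 unitfE negbK.
Qed.

Definition unit_norm (a : units L) : units k := Units (res_norm_unit a).

Definition torus_norm n (s : torus n L) : torus n k := torus_map unit_norm s.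
End Norm.

(* A split connected reductive group with a split maximal torus and a Borel
   subgroup containing it is represented by its based root datum, the Borel
   subgroup being recorded by its positive system. *)
Record basedRootDatum (n : nat) := BasedRootDatum {
  roots : {fset 'rV[int]_n};
  coroot : 'rV[int]_n -> 'cV[int]_n; (* only used on roots *)
  posroots : {fset 'rV[int]_n};
  coroot_inj : {in roots &, injective coroot};
  root_coroot : forall alpha, alpha \in roots ->
    pairing alpha (coroot alpha) = 2;
  root_reduced : forall alpha, alpha \in roots -> alpha *+ 2 \notin roots;
  root_stable : forall alpha beta, alpha \in roots -> beta \in roots ->
    beta - pairing beta (coroot alpha) *: alpha \in roots;
  coroot_stable : forall alpha beta, alpha \in roots -> beta \in roots ->
    exists2 gamma, gamma \in roots &
      coroot beta - pairing alpha (coroot beta) *: coroot alpha = coroot gamma;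
  pos_root : {subset posroots <= roots};
  pos_opp : forall alpha, alpha \in roots ->
    (alpha \in posroots) = (- alpha \notin posroots);
  posD : forall alpha beta, alpha \in posroots -> beta \in posroots ->
    alpha + beta \in roots -> alpha + beta \in posroots }.

Section RootDatum.
Variables (n : nat) (D : basedRootDatum n).
Implicit Types (alpha : 'rV[int]_n) (lambda mu nu : 'cV[int]_n) (M : 'M[int]_n).

(* X^*(T)/Z Phi, the character group of the center, is torsion free, i.e. the
   center is a torus. *)
Definition connected_center : Prop := forall (m : nat) (xi : 'rV[int]_n),
  (0 < m)%N -> zspan [set` roots D] (xi *+ m) -> zspan [set` roots D] xi.

(* The derived group is simply connected iff X_*(T)/Z Phi^vee is torsion
   free. *)
Definition simply_connected_derived : Prop :=
  forall (m : nat) (nu : 'cV[int]_n), (0 < m)%N ->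
  zspan (coroot D @` [set` roots D]) (nu *+ m) ->
  zspan (coroot D @` [set` roots D]) nu.

Definition dominant mu : Prop :=
  forall alpha, alpha \in posroots D -> 0 <= pairing alpha mu.

Definition minuscule mu : Prop :=
  forall alpha, alpha \in roots D -> `|pairing alpha mu| <= 1.

Definition root_subsystem (J : {fset 'rV[int]_n}) : Prop :=
  {subset J <= roots D} /\
  forall alpha beta, alpha \in J -> beta \in J ->
    beta - pairing beta (coroot D alpha) *: alpha \in J.

Definition refl_mx alpha : 'M[int]_n := 1%:M - coroot D alpha *m alpha.

Inductive weyl : set 'M[int]_n :=
| weyl1 : weyl 1%:M
| weyl_refl alpha M : alpha \in roots D -> weyl M -> weyl (refl_mx alpha *m M).

(* The pair (lambda, M) stands for t_lambda M; it lies in the extended affine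
   Weyl group when weyl M holds. *)
Definition eaff := ('cV[int]_n * 'M[int]_n)%type.
Implicit Types x y : eaff.

Definition eaff1 : eaff := (0, 1%:M).
Definition eaff_mul x y : eaff := (x.1 + x.2 *m y.1, x.2 *m y.2).
Definition transl lambda : eaff := (lambda, 1%:M).

Section Bruhat.
Variable R : realType.

Definition rpairing alpha (v : 'cV[R]_n) : R := (map_mx intr alpha *m v) 0 0.

Definition eaff_act x (v : 'cV[R]_n) : 'cV[R]_n :=
  map_mx intr x.1 + map_mx intr x.2 *m v.

Definition base_alcove : set 'cV[R]_n :=
  [set v | forall alpha, alpha \in posroots D -> 0 < rpairing alpha v < 1].

(* The reflection in the hyperplane <alpha, v> = k. *)
Definition aff_refl alpha (k : int) : eaff :=
  (k *: coroot D alpha, refl_mx alpha).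

(* <alpha, v> = k is a wall of the base alcove: the closure of the alcove has a
   point on this hyperplane and on no other root hyperplane. *)
Definition is_wall alpha (k : int) : Prop := exists v : 'cV[R]_n,
  [/\ closure base_alcove v, rpairing alpha v = k%:~R &
     forall beta (m : int), beta \in roots D -> rpairing beta v = m%:~R ->
       beta = alpha \/ beta = - alpha].

Definition simple_aff_refl : set eaff :=
  [set x | exists alpha k,
     [/\ alpha \in roots D, is_wall alpha k & x = aff_refl alpha k]].

Definition word_prod (s : seq eaff) : eaff := foldr eaff_mul eaff1 s.

Definition is_word (s : seq eaff) : Prop :=
  forall x, x \in s -> simple_aff_refl x.

Definition reduced (s : seq eaff) : Prop :=
  is_word s /\
  forall s', is_word s' -> word_prod s' = word_prod s -> (size s <= size s')%N.

(* Bruhat order of the Coxeter group generated by simple_aff_refl, by subwords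
   of reduced words. *)
Definition bruhat_aff x y : Prop := exists s u,
  [/\ reduced s, word_prod s = y, subseq u s & word_prod u = x].

Definition alcove_stab : set eaff :=
  [set x | weyl x.2 /\ eaff_act x @` base_alcove = base_alcove].

Definition bruhat x y : Prop := exists x' y' tau,
  [/\ alcove_stab tau, x = eaff_mul x' tau, y = eaff_mul y' tau &
     bruhat_aff x' y'].

Definition admissible mu x : Prop :=
  weyl x.2 /\ exists2 M, weyl M & bruhat x (transl (M *m mu)).

End Bruhat.

Definition L_lattice (w : eaff) (J : {fset 'rV[int]_n}) : set 'cV[int]_n :=
  zspan ([set w.1 + w.2 *m nu - nu | nu in [set: 'cV[int]_n]] `|`
         coroot D @` [set` J]).

Definition critical_group (k : fieldType) (w : eaff) (J : {fset 'rV[int]_n}) :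
    set (torus n k) :=
  gspan [set t | exists2 nu, L_lattice w J nu & exists a, t = cochar nu a].

End RootDatum.

(* M kappa is characterized by nu (M kappa) = (M^-1 nu) (kappa). *)
Definition dual_act n A (M : 'M[int]_n) (kappa : torus n A) : torus n A :=
  [ffun i => dual_char (invmx M *m delta_mx i 0) kappa].

Section LatticeMorphism.
Variables (n : nat) (A : comUnitRingType) (phi : 'cV[int]_n -> units A).
Hypothesis phiD : forall x y, phi (x + y) = (phi x * phi y)%g.

Lemma lattice_morph_uprod nu :
  phi nu = uprod (fun i => uexpz (phi (delta_mx i 0)) (nu i 0)).
Proof.
have phi0 : phi 0 = 1%g.
  by apply: (mulgI (phi 0)); rewrite -phiD addr0 mulg1.
have phi_nat x (m : nat) : uval (phi (x *+ m)) = uval (phi x) ^+ m.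
  elim: m => [|m IHm]; first by rewrite mulr0n phi0.
  by rewrite mulrS phiD /= IHm exprS.
have phiZ x (m : int) : uval (phi (m *: x)) = uval (phi x) ^ m.
  case: m => m; first by rewrite -exprnP -phi_nat -scaler_nat natz.
  rewrite NegzE -exprnN -phi_nat scaleNr -scaler_nat natz.
  have : uval (phi (m.+1%:Z *: x)) * uval (phi (- (m.+1%:Z *: x))) = 1.
    by have /(congr1 val)/= <- := phiD (m.+1%:Z *: x) (- (m.+1%:Z *: x)); rewrite subrr phi0.
  by move/(canRL (mulKr (uvalP _))) ->; rewrite mulr1.
apply/val_inj => /=.
have -> : nu = \sum_i nu i 0 *: delta_mx i 0.
  by rewrite [LHS]matrix_sum_delta; apply: eq_bigr => i _; rewrite big_ord1.
have morph (I : finType) (F : I -> 'cV[int]_n) :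
    uval (phi (\sum_i F i)) = \prod_i uval (phi (F i)).
  by apply: (big_morph (fun x => uval (phi x))) => [x y|]; rewrite ?phiD ?phi0.
rewrite morph; apply: eq_bigr => i _; rewrite phiZ; congr (_ ^ _).
rewrite summxE (bigD1 i) //= big1 => [|j ji]; rewrite !mxE ?eqxx ?mulr1 ?addr0 //.
by rewrite eq_sym (negPf ji) mulr0.
Qed.
End LatticeMorphism.

Lemma dual_charD n A (x y : 'cV[int]_n) (kappa : torus n A) :
  dual_char (x + y) kappa = (dual_char x kappa * dual_char y kappa)%g.
Proof.
apply/val_inj; rewrite /= -big_split; apply: eq_bigr => i _.
by rewrite mxE exprzDr ?uvalP.
Qed.

Lemma cocharD n A (x y : 'cV[int]_n) (a : units A) :
  cochar (x + y) a = (cochar x a * cochar y a)%g.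
Proof.
apply/ffunP => i; rewrite !ffunE; apply/val_inj.
by rewrite /= !mxE exprzDr ?uvalP.
Qed.

Lemma dual_actE n A (M : 'M[int]_n) (kappa : torus n A) nu :
  dual_char nu (dual_act M kappa) = dual_char (invmx M *m nu) kappa.
Proof.
rewrite (@lattice_morph_uprod _ _ (fun x => dual_char (invmx M *m x) kappa)).
  by apply/val_inj/eq_bigr => i _; rewrite ffunE.
by move=> x y; rewrite mulmxDr dual_charD.
Qed.

Section Endoscopic.
Variables (n : nat) (F : localField) (R : realType).
Notation C := R[i].

Record depthZeroChar := DepthZeroChar {
  dz_char :> {multiplicative torus n (lf_int F) -> units C};
  dz_res : {multiplicative torus n (lf_res F) -> units C};
  dz_factor : forall t,
    dz_char t = dz_res (torus_map (units_map (lf_red F)) t) }.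

(* u stands for tau_F(x), the image in O_F^* of the chosen inertia element. *)
Definition kappa_of (u : units (lf_int F)) (chi : depthZeroChar) : torus n C :=
  [ffun i => chi (cochar (delta_mx i 0) u)].

Lemma kappa_ofE u chi nu :
  dual_char nu (kappa_of u chi) = chi (cochar nu u).
Proof.
rewrite (@lattice_morph_uprod _ _ (fun x => chi (cochar x u))).
  by apply/val_inj/eq_bigr => i _; rewrite ffunE.
by move=> x y; rewrite cocharD gmulfM.
Qed.

Variable D : basedRootDatum n.

Definition S_group (w : eaff n) : set (torus n C) :=
  [set kappa | dual_act w.2 kappa = kappa /\ dual_char w.1 kappa = 1%g].

Definition S_groupJ (w : eaff n) (J : {fset 'rV[int]_n}) : set (torus n C) :=
  S_group w `&`
  [set kappa | forall alpha, alpha \in J -> dual_char (coroot D alpha) kappa = 1%g].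

Definition S_dz (u : units (lf_int F)) (w : eaff n) (J : {fset 'rV[int]_n}) :
    set (torus n C) :=
  S_groupJ w J `&` [set kappa | exists chi, kappa = kappa_of u chi].

Lemma S_dz_finite u w J : finite_set (S_dz u w J).
Proof.
pose q := #|lf_res F|; pose p : {poly C} := 'X^q - 'X.
have q1 : (1 < q)%N := finNzRing_gt1 (lf_res F).
have p0 : p != 0.
  rewrite -size_poly_eq0 size_polyDl ?size_polyXn //.
  by rewrite size_polyN size_polyX ltnS.
have [rs Dp] := closed_field_poly_normal p.
pose f (g : {ffun 'I_n -> 'I_(size rs)}) : torus n C :=
  [ffun i => insubd (units_one _) (nth 0 rs (g i))].
apply: (@sub_finite_set _ _ (f @` setT)); last exact: finite_image.
move=> kappa [_ [chi ->]].
have inrs i : uval (kappa_of u chi i) \in rs.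
  suff: root p (uval (kappa_of u chi i)).
    by rewrite Dp rootZ ?lead_coef_eq0 // root_prod_XsubC.
  rewrite rootE !hornerE subr_eq0 ffunE dz_factor; apply/eqP.
  set t := torus_map _ _.
  have tq : (t ^+ q)%g = t.
    apply/ffunP => j; apply/val_inj.
    have pow m : uval ((t ^+ m)%g j) = uval (t j) ^+ m.
      elim: m => [|m IHm]; first by rewrite expg0 ffunE.
      by rewrite expgS ffunE /= IHm exprS.
    by rewrite [LHS]pow expf_card.
  have pow (x : units C) m : uval (x ^+ m)%g = uval x ^+ m.
    by elim: m => [//|m IHm]; rewrite expgS /= IHm exprS.
  have hom1 : dz_res chi 1%g = 1%g.
    by apply: (mulgI (dz_res chi 1%g)); rewrite -gmulfM !mulg1.
  have homX m : dz_res chi (t ^+ m)%g = (dz_res chi t ^+ m)%g.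
    by elim: m => [//|m IHm]; rewrite !expgS gmulfM IHm.
  by rewrite -[in RHS]tq homX pow.
have idx i : (index (uval (kappa_of u chi i)) rs < size rs)%N.
  by rewrite index_mem.
exists [ffun i => Ordinal (idx i)] => //; apply/ffunP => i.
rewrite [LHS]ffunE [in LHS]ffunE /= nth_index //.
by apply/val_inj; rewrite val_insubd uvalP.
Qed.
End Endoscopic.

Arguments S_dz {n F} R D u w J _.

(* Main.v *)
(* Let g generate the multiplicative group of k_F, let N be its order, and write
   N_r(s) = m(g) with m in X_*(T).  The set S_dz consists of the kappa with
   kappa^N = 1 on which L_{w,J} is trivial, so it is a finite group, and gamma
   and m agree on it.  If m lies in L_{w,J} + N X_*(T), then N_r(s) lies in the
   critical group; otherwise the Smith normal form gives a linear form f on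
   X_*(T) with values in N Z on L_{w,J} + N X_*(T) but not at m, and a primitive
   N-th root of unity zeta turns f into an element kappa0 = zeta^f of S_dz with
   m(kappa0) <> 1.  In that case translation by kappa0 multiplies the sum by a
   scalar different from 1, so the sum vanishes. *)

Require Import Defs.
From HB Require Import structures.
From mathcomp Require Import all_boot all_order all_algebra all_field finmap complex cyclic.
From mathcomp Require Import boolp classical_sets functions cardinality fsbigop reals.

Set Implicit Arguments.
Unset Strict Implicit.
Unset Printing Implicit Defensive.

Import Order.TTheory GRing.Theory Num.Theory.
Local Open Scope classical_set_scope.
Local Open Scope ring_scope.

(** * Primitive roots of unity and their integer powers *)

Lemma closed_prim_root_exists (C : closedFieldType) (N : nat) :
  N%:R != 0 :> C -> exists z : C, N.-primitive_root z.
Proof.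
move=> nzN; have N_gt0 : (0 < N)%N by case: N nzN => //; rewrite eqxx.
pose p : {poly C} := 'X^N - 1; have [rs Dp] := closed_field_poly_normal p.
rewrite (monicP _) ?monicXnsubC // scale1r in Dp.
have rsN : all N.-unity_root rs by apply/allP=> z; rewrite -root_prod_XsubC -Dp.
have sz_rs : (N < (size rs).+1)%N.
  by rewrite -(size_prod_XsubC rs id) -Dp size_XnsubC.
(* N roots of unity of order dividing N include a primitive one as soon as they are distinct; here
   this is separability of X^N - 1, valid because N is nonzero in the field. *)
have [|z] := hasP (has_prim_root N_gt0 rsN _ sz_rs); last by exists z.
by rewrite -separable_prod_XsubC -Dp cyclotomic.separable_Xn_sub_1.
Qed.

Lemma unity_expz (C : unitRingType) (N : nat) (z : C) (m : int) :
  z ^+ N = 1 -> (N %| m)%Z -> z ^ m = 1.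
Proof. by move=> zN /dvdzP[q ->]; rewrite mulrC -exprz_exp -exprnP zN exp1rz. Qed.

Lemma prim_expz_eq1 (K : fieldType) (N : nat) (z : K) (m : int) :
  N.-primitive_root z -> (z ^ m == 1) = (N %| m)%Z.
Proof.
move=> zN; case: m => m; first by rewrite dvdzE -(prim_order_dvd zN).
by rewrite NegzE -exprnN invr_eq1 -(prim_order_dvd zN) dvdzE.
Qed.

(** * Separating a point from a lattice that contains N times the standard lattice *)

Section LatticeSeparation.
Variables (n N : nat) (P : set 'cV[int]_n).
Hypotheses (N_gt0 : (0 < N)%N) (P0 : P 0).
Hypothesis PB : forall x y, P x -> P y -> P (x - y).
Hypothesis PN : forall x, P (x *+ N).

Lemma subgroup_closedD x y : P x -> P y -> P (x + y).
Proof. by move=> Px Py; rewrite -[y]opprK -[- y]sub0r; do 2 apply: PB => //. Qed.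

Lemma subgroup_closedZ (m : int) x : P x -> P (m *: x).
Proof.
have PM k : P x -> P (x *+ k).
  by move=> Px; elim: k => [//|k IHk]; rewrite mulrS; apply: subgroup_closedD.
case: m => k Px; first by rewrite -natz scaler_nat; apply: PM.
by rewrite NegzE scaleNr -natz scaler_nat -sub0r; apply: PB => //; apply: PM.
Qed.

(* The small representatives of the classes of P modulo N, together with N
   times the standard basis, generate P. *)
Lemma lattice_finitely_generated :
  exists k (A : 'M[int]_(n, n + k)), forall v, P v <-> exists x, v = A *m x.
Proof.
pose rep (g : 'cV['I_N]_n) : 'cV[int]_n := map_mx (fun i : 'I_N => (i : nat)%:Z) g.
(* Residue classes outside [P] contribute a zero column, so every column of [A] lies in [P]. *)
pose B : 'M[int]_(n, #|{: 'cV['I_N]_n}|) :=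
  \matrix_(i, j) if `[< P (rep (enum_val j)) >] then rep (enum_val j) i 0 else 0.
pose A := row_mx (N%:Z%:M : 'M[int]_n) B.
exists #|{: 'cV['I_N]_n}|, A => v; split=> [Pv | [x ->]].
- have modlt i : (`|(v i 0%R %% N)%Z|%N < N)%N.
    by rewrite -ltz_nat gez0_abs ?modz_ge0 ?ltz_pmod // -lt0n.
  pose g : 'cV['I_N]_n := \col_i Ordinal (modlt i).
  pose q : 'cV[int]_n := \col_i (v i 0%R %/ N)%Z.
  have Dv : v = q *+ N + rep g.
    apply/colP => i; rewrite mxE mulmxnE !mxE /= gez0_abs ?modz_ge0 -?lt0n //.
    by rewrite {1}(divz_eq (v i 0) N) -mulr_natr natz.
  have Pg : P (rep g) by rewrite -[rep g](addKr (q *+ N)) -Dv addrC; apply: PB.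
  (* The quotient by N weighs the columns of N times the identity; the delta selects the column of
     the residue class. *)
  exists (col_mx q (delta_mx (enum_rank g) 0)).
  rewrite mul_row_col mul_scalar_mx -natz scaler_nat -colE {1}Dv; congr (_ + _).
  by apply/colP => i; rewrite [RHS]mxE [RHS]mxE enum_rankK asboolT.
rewrite -[x]vsubmxK mul_row_col mul_scalar_mx -natz scaler_nat.
apply: subgroup_closedD => //.
have -> : B *m dsubmx x = \sum_j dsubmx x j 0 *: col j B.
  apply/colP => i; rewrite mxE summxE; apply: eq_bigr => j _.
  by rewrite !mxE mulrC.
apply: big_rec => // j y _ Py; apply: subgroup_closedD Py.
apply: subgroup_closedZ; set c := col j B.
suff -> : c = if `[< P (rep (enum_val j)) >] then rep (enum_val j) else 0.
  by case: asboolP.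
by apply/colP => i; rewrite !mxE; case: ifP; rewrite !mxE.
Qed.

(* In a basis adapted to P by the Smith normal form, P is cut out by
   divisibility of the coordinates by the invariant factors d_i, which divide
   N; f is N / d_i times a coordinate that witnesses that m is not in P. *)
Lemma lattice_separation (m : 'cV[int]_n) : ~ P m ->
  exists2 f : 'rV[int]_n, forall v, P v -> (N %| pairing f v)%Z &
    ~~ (N %| pairing f m)%Z.
Proof.
move=> nPm; have [k [A PA]] := lattice_finitely_generated.
have [L uL [T uT [d _ DA]]] := int_Smith_normal_form A.
set E := \matrix_(i, j) _ in DA.
have EE y (i : 'I_n) : (E *m y) i (0 : 'I_1) = d`_i * y (lshift k i) 0.
  rewrite mxE (bigD1 (lshift k i)) //= mxE eqxx big1 ?addr0 // => j ji.
  by rewrite mxE -[i : nat]/(lshift k i : nat) val_eqE eq_sym (negPf ji) mul0r.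
have PE v : P v -> exists y, invmx L *m v = E *m y.
  by case/PA=> x ->; exists (T *m x); rewrite DA -!mulmxA mulKmx.
(* Apply [PE] to N times the i-th vector of the adapted basis: its i-th coordinate is N. Since N >
   0, this also excludes a zero invariant factor. *)
have dN (i : 'I_n) : (d`_i %| N%:Z)%Z.
  have [y] := PE _ (PN (L *m delta_mx i 0)).
  rewrite -scaler_nat -scalemxAr mulKmx // => /colP/(_ i).
  rewrite EE !mxE !eqxx mulr1 natz => ->; exact: dvdz_mulr.
have [i ndi] : exists i, ~~ (d`_i %| (invmx L *m m) i 0%R)%Z.
  apply: contrapT => nex; apply/nPm/PA.
  have dvd_coord i : (d`_i %| (invmx L *m m) i 0%R)%Z.
    by apply: contrapT => /negP ndi; apply: nex; exists i.
  pose y := col_mx (\col_i ((invmx L *m m) i 0%R %/ d`_i)%Z) (0 : 'cV[int]_k).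
  exists (invmx T *m y); rewrite DA -!mulmxA mulKVmx //.
  rewrite -[LHS](mulKVmx uL); congr (_ *m _); apply/colP => i.
  by rewrite EE col_mxEu [in RHS]mxE mulrC divzK.
have fE v : pairing ((N %/ d`_i)%Z *: row i (invmx L)) v =
    (N %/ d`_i)%Z * (invmx L *m v) i 0.
  by rewrite /pairing -scalemxAl mxE -row_mul [in LHS]mxE.
have Nd : (N %/ d`_i)%Z * d`_i = N by rewrite divzK.
exists ((N %/ d`_i)%Z *: row i (invmx L)) => [v /PE[y Ev]|].
  by rewrite fE Ev EE mulrA Nd dvdz_mulr.
(* Write N as (N / d_i) d_i and cancel N / d_i, which is nonzero because N is. *)
rewrite fE -[X in dvdz X]Nd dvdz_mul2l //; apply: contraTneq N_gt0 => Nd0.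
by move: Nd; rewrite Nd0 mul0r => -[<-].
Qed.

End LatticeSeparation.

(* For groupTypes {multiplicative _ -> _} only records compatibility with
   products. *)
Lemma multiplicative1 (G H : groupType) (f : {multiplicative G -> H}) :
  f 1%g = 1%g.
Proof. by apply: (mulgI (f 1%g)); rewrite -gmulfM !mulg1. Qed.

Lemma multiplicativeX (G H : groupType) (f : {multiplicative G -> H}) x m :
  f (x ^+ m)%g = (f x ^+ m)%g.
Proof.
by elim: m => [|m IHm]; rewrite ?expg0 ?multiplicative1 // !expgS gmulfM IHm.
Qed.

Lemma multiplicative_div (G H : groupType) (f : {multiplicative G -> H}) x y :
  f x = 1%g -> f y = 1%g -> f (x * y^-1)%g = 1%g.
Proof.
move=> fx fy; apply: (mulIg (f y)).
by rewrite -gmulfM mulgVK fx fy mul1g.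
Qed.

(** Each reflection squares to the identity because a root pairs to 2 with its coroot. Invertibility
    makes [invmx] in [dual_act] a genuine inverse. *)
Lemma weyl_unitmx n (D : basedRootDatum n) M : weyl D M -> M \in unitmx.
Proof.
elim=> [|alpha {}M Ra _ uM]; first exact: unitmx1.
rewrite unitmx_mul uM andbT.
suff : refl_mx D alpha *m refl_mx D alpha = 1%:M by case/mulmx1_unit.
have aa : alpha *m coroot D alpha = 2%:M.
  by rewrite [LHS]mx11_scalar -(root_coroot Ra).
rewrite /refl_mx mulmxBl !mul1mx mulmxBr mulmx1.
rewrite -mulmxA (mulmxA alpha) aa mul_scalar_mx -scalemxAr.
by rewrite scaler_nat mulr2n opprB addrK subrK.
Qed.

(** * Calculus of cocharacters and dual characters on split tori *)

Section Units.
Variable A : comUnitRingType.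
Implicit Types (a b : units A).

Lemma uval_exp a m : uval (a ^+ m)%g = uval a ^+ m.
Proof. by elim: m => [//|m IHm]; rewrite expgS /= IHm exprS. Qed.

Lemma uexpz_nat a (m : nat) : uexpz a m = (a ^+ m)%g.
Proof. by apply/val_inj; rewrite /= uval_exp. Qed.

Variable n : nat.
Implicit Types (kappa t : torus n A) (nu : 'cV[int]_n).

Lemma torus_expE t m i : (t ^+ m)%g i = (t i ^+ m)%g.
Proof.
by elim: m => [|m IHm]; rewrite ?expg0 ?ffunE // !expgS ffunE IHm.
Qed.

Lemma cochar_exp nu a m : cochar nu (a ^+ m)%g = (cochar nu a ^+ m)%g.
Proof.
apply/ffunP => i; rewrite torus_expE !ffunE; apply/val_inj.
by rewrite /= !uval_exp /= !exprnP exprzAC.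
Qed.

Lemma dual_char0 kappa : dual_char 0 kappa = 1%g.
Proof. by apply: (mulgI (dual_char 0 kappa)); rewrite -dual_charD addr0 mulg1. Qed.

Lemma dual_charB x y kappa :
  dual_char (x - y) kappa = (dual_char x kappa * (dual_char y kappa)^-1)%g.
Proof.
by apply: (mulIg (dual_char y kappa)); rewrite -dual_charD subrK mulgVK.
Qed.

Lemma dual_char_delta i kappa : dual_char (delta_mx i 0) kappa = kappa i.
Proof.
apply/val_inj; rewrite /= (bigD1 i) //= mxE !eqxx big1 ?mulr1 //.
by move=> j ji; rewrite mxE (negPf ji).
Qed.

Lemma dual_charM nu kappa kappa' :
  dual_char nu (kappa * kappa')%g = (dual_char nu kappa * dual_char nu kappa')%g.
Proof.
apply/val_inj; rewrite /= -big_split; apply: eq_bigr => i _.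
by rewrite ffunE /= exprMz_comm ?uvalP //; apply: mulrC.
Qed.

Lemma dual_charV nu kappa :
  dual_char nu kappa^-1%g = (dual_char nu kappa)^-1%g.
Proof.
apply: (mulIg (dual_char nu kappa)); rewrite -dual_charM !mulVg.
by apply/val_inj; rewrite /= big1 // => i _; rewrite ffunE /= exp1rz.
Qed.

Lemma dual_char_unity N nu kappa :
    (forall i, uval (kappa i) ^+ N = 1) -> (forall i, (N %| nu i 0%R)%Z) ->
  dual_char nu kappa = 1%g.
Proof.
move=> kN dN; apply/val_inj; rewrite /= big1 // => i _.
exact: unity_expz (kN i) (dN i).
Qed.

Lemma torus_map_cochar (B : comUnitRingType) (f : {rmorphism A -> B}) nu a :
  torus_map (units_map f) (cochar nu a) = cochar nu (units_map f a).
Proof.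
apply/ffunP => i; rewrite !ffunE; apply/val_inj => /=.
by case: (nu i 0) => m; rewrite ?NegzE -?exprnN /= ?rmorphV ?rmorphXn ?unitrX ?uvalP.
Qed.

Lemma torus_mapM (B : comUnitRingType) (f : {rmorphism A -> B}) t t' :
  torus_map (units_map f) (t * t')%g =
  (torus_map (units_map f) t * torus_map (units_map f) t')%g.
Proof. by apply/ffunP => i; rewrite !ffunE; apply/val_inj; rewrite /= rmorphM. Qed.

End Units.

(* The discrete logarithm to base g, taken coordinatewise, is additive only
   modulo N, which is enough because kappa has exponent N. *)
Lemma dual_char_dlog (A : comUnitRingType) (k : fieldType) (n N : nat)
    (g : units k) (kappa : torus n A) :
    N.-primitive_root (uval g) -> (forall a : units k, exists m : nat, a = (g ^+ m)%g) ->
    (forall i, uval (kappa i) ^+ N = 1) ->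
  exists f : {multiplicative torus n k -> units A},
    forall nu, f (cochar nu g) = dual_char nu kappa.
Proof.
move=> gN gen kN; have [dlog dlogK] := choice gen.
pose nlog (t : torus n k) : 'cV[int]_n := \col_i (dlog (t i))%:Z.
have nlogK (t : torus n k) : cochar (nlog t) g = t.
  by apply/ffunP => i; rewrite ffunE mxE uexpz_nat -dlogK.
have congr_dual nu nu' : cochar nu g = cochar nu' g ->
    dual_char nu kappa = dual_char nu' kappa.
  move=> eq_nu; suff: dual_char (nu - nu') kappa = 1%g.
    by rewrite dual_charB => /divg1_eq.
  apply: dual_char_unity kN _ => i; rewrite -(prim_expz_eq1 _ gN).
  move/ffunP/(_ i): eq_nu; rewrite !ffunE => /(congr1 val)/= eq_i.
  by rewrite !mxE expfzDr -?unitfE ?uvalP // eq_i -expfzDr -?unitfE ?uvalP // subrr.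
pose f t := dual_char (nlog t) kappa.
have fM : {morph f : t t' / (t * t')%g}.
  by move=> t t'; rewrite -dual_charD; apply: congr_dual; rewrite cocharD !nlogK.
pose F : {multiplicative torus n k -> units A} :=
  HB.pack f (isMultiplicative.Build _ _ f fM).
exists F => nu.
by apply: congr_dual; rewrite nlogK.
Qed.


(** * Depth-zero characters, and duality between [S_dz] and the critical group *)

Section DepthZero.
Variables (n : nat) (F : localField) (R : realType).
Notation C := R[i].
Variables (u : units (lf_int F)) (N : nat).
Let g := units_map (lf_red F) u.
Hypothesis gN : N.-primitive_root (uval g).
Hypothesis g_gen : forall a : units (lf_res F), exists m : nat, a = (g ^+ m)%g.
Implicit Types (kappa : torus n C) (chi : depthZeroChar n F R).

(** Bridge between the two sides: values of chi on T(k_F) become values of characters at the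
    endoscopic element. *)
Lemma dz_resE chi nu : dz_res chi (cochar nu g) = dual_char nu (kappa_of u chi).
Proof. by rewrite kappa_ofE dz_factor torus_map_cochar. Qed.

Lemma kappa_of_unity chi i : uval (kappa_of u chi i) ^+ N = 1.
Proof.
rewrite -dual_char_delta -dz_resE -uval_exp -multiplicativeX -cochar_exp.
suff -> : (g ^+ N)%g = 1%g.
  have -> : cochar (delta_mx i 0) 1%g = 1%g :> torus n (lf_res F).
    by apply/ffunP => j; rewrite !ffunE; apply/val_inj; rewrite /= exp1rz.
  by rewrite multiplicative1.
by apply/val_inj; rewrite /= uval_exp (prim_expr_order gN).
Qed.

(** A torus element killed by N defines a character of T(k_F) through discrete logarithms; inflating
    it along reduction gives chi. *)
Lemma kappa_of_surj kappa :
  (forall i, uval (kappa i) ^+ N = 1) -> exists chi, kappa = kappa_of u chi.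
Proof.
move=> kN; have [f fE] := dual_char_dlog gN g_gen kN.
pose f0 (t : torus n (lf_int F)) := f (torus_map (units_map (lf_red F)) t).
have f0M : {morph f0 : t t' / (t * t')%g}.
  by move=> t t'; rewrite /f0 torus_mapM gmulfM.
pose f1 : {multiplicative torus n (lf_int F) -> units C} :=
  HB.pack f0 (isMultiplicative.Build _ _ f0 f0M).
have f1E t : f1 t = f (torus_map (units_map (lf_red F)) t) by [].
exists (DepthZeroChar f1E); apply/ffunP => i.
by rewrite -[RHS]dual_char_delta -dz_resE /= fE dual_char_delta.
Qed.

Variables (D : basedRootDatum n) (w : eaff n) (J : {fset 'rV[int]_n}).
Hypothesis uw : w.2 \in unitmx.

Lemma S_groupJP kappa :
  S_groupJ D w J kappa <-> forall nu, L_lattice D w J nu -> dual_char nu kappa = 1%g.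
Proof.
split=> [[[fix_w w1] kJ] nu|kL].
  elim=> [|x [[y _ <-]|[alpha /= Ja <-]]|x y _ xP _ yP].
  - exact: dual_char0.
  - rewrite dual_charB dual_charD w1 mul1g.
    by rewrite -{1}fix_w dual_actE mulKmx // mulgV.
  - exact: kJ.
  - by rewrite dual_charB xP yP mulgV.
have kw nu : dual_char (w.1 + w.2 *m nu - nu) kappa = 1%g.
  by apply/kL/zspan_mem; left; exists nu.
(* Taking nu = 0 isolates lambda; the other generators then give invariance under the finite part of
   [w]. *)
have w1 : dual_char w.1 kappa = 1%g.
  by have := kw 0; rewrite mulmx0 subr0 addr0.
split; last by move=> alpha Ja; apply/kL/zspan_mem; right; exists alpha.
split=> //; apply/ffunP => i; rewrite -!dual_char_delta dual_actE.
apply/esym/divg1_eq; rewrite -[RHS](kw (invmx w.2 *m delta_mx i 0)).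
by rewrite mulKVmx // dual_charB dual_charD w1 mul1g.
Qed.

Lemma S_dzP kappa : S_dz R D u w J kappa <->
  (forall nu, L_lattice D w J nu -> dual_char nu kappa = 1%g) /\
  (forall i, uval (kappa i) ^+ N = 1).
Proof.
split=> [[/S_groupJP kL [chi Dk]]|[kL kN]].
  by split=> // i; rewrite Dk kappa_of_unity.
by split; [exact/S_groupJP | exact: kappa_of_surj].
Qed.

(** Duality for the finite group T(k_F): the critical group is the common kernel of the characters
    attached to [S_dz]. The converse direction rests on lattice separation. *)
Lemma critical_groupP m : critical_group D w J (cochar m g) <->
  forall kappa, S_dz R D u w J kappa -> dual_char m kappa = 1%g.
Proof.
split=> [Am kappa kS | mS].
  have [kL _] := (S_dzP kappa).1 kS; have [_ [chi Dk]] := kS.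
  rewrite Dk -dz_resE; elim: Am => [|x [nu Lnu [a ->]]|x y _ x1 _ y1].
  - exact: multiplicative1.
  - have [j ->] := g_gen a.
    by rewrite cochar_exp multiplicativeX dz_resE -Dk kL // expg1n.
  - exact: multiplicative_div.
have N_gt0 := prim_order_gt0 gN.
(* Adding N X_*(T) to the lattice does not change values at [g], which has order N, and provides the
   multiples of N required for separation. *)
pose P := [set v | exists2 l, L_lattice D w J l & exists z, v = l + z *+ N].
have [[l Ll [z ->]] | nPm] := pselect (P m).
  rewrite cocharD; suff -> : cochar (z *+ N) g = 1%g.
    by rewrite mulg1; apply: gspan_mem; exists l => //; exists g.
  apply/ffunP => i; rewrite !ffunE; apply/val_inj => /=.
  apply/eqP; rewrite (prim_expz_eq1 _ gN) mulmxnE -mulr_natr natz.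
  exact: dvdz_mull.
have P0 : P 0.
  by exists 0; [exact: zspan0 | exists 0; rewrite mul0rn addr0].
have PB x y : P x -> P y -> P (x - y).
  case=> [l Ll [z ->]] [l' Ll' [z' ->]]; exists (l - l'); first exact: zspanB.
  by exists (z - z'); rewrite mulrnBl opprD addrACA.
have PN x : P (x *+ N).
  by exists 0; [exact: zspan0 | exists x; rewrite add0r].
have [f fP nfm] := lattice_separation N_gt0 P0 PB PN nPm.
have [zeta zetaN] : exists zeta : C, N.-primitive_root zeta.
  by apply: closed_prim_root_exists; rewrite pnatr_eq0 -lt0n.
have zeta_unit : zeta \is a GRing.unit by rewrite unitfE (prim_root_eq0 zetaN) -lt0n.
pose kappa : torus n C := [ffun i => uexpz (Units zeta_unit) (f 0 i)].
have kE nu : uval (dual_char nu kappa) = zeta ^ pairing f nu.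
  rewrite /pairing mxE /=.
  have -> : zeta ^ (\sum_j f 0 j * nu j 0) = \prod_j zeta ^ (f 0 j * nu j 0).
    apply: (big_morph (fun x : int => zeta ^ x)) => // x y.
    by rewrite exprzDr.
  by apply: eq_bigr => j _; rewrite ffunE /= exprz_exp.
suff kS : S_dz R D u w J kappa.
  case/negP: nfm; rewrite -(prim_expz_eq1 _ zetaN) -kE.
  by rewrite mS.
apply/S_dzP; split=> [nu Lnu|i].
  apply/val_inj; rewrite [LHS]kE; apply/eqP; rewrite (prim_expz_eq1 _ zetaN); apply: fP.
  by exists nu => //; exists 0; rewrite mul0rn addr0.
by rewrite ffunE /= exprnP exprzAC -exprnP (prim_expr_order zetaN) exp1rz.
Qed.

Lemma S_dzM kappa kappa' :
  S_dz R D u w J kappa -> S_dz R D u w J kappa' -> S_dz R D u w J (kappa * kappa')%g.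
Proof.
move=> /S_dzP[kL kN] /S_dzP[kL' kN']; apply/S_dzP; split=> [nu Lnu|i].
  by rewrite dual_charM kL // kL' // mulg1.
by rewrite ffunE /= exprMn kN kN' mulr1.
Qed.

Lemma S_dzV kappa : S_dz R D u w J kappa -> S_dz R D u w J kappa^-1%g.
Proof.
move=> /S_dzP[kL kN]; apply/S_dzP; split=> [nu Lnu|i].
  by rewrite dual_charV kL // invg1.
by rewrite ffunE /= exprVn kN invr1.
Qed.

End DepthZero.

Theorem proposition3p29 (R : realType) (F : localField) (r : nat)
    (Fr : unramifiedExt F r) (n : nat) (D : basedRootDatum n)
    (hcenter : connected_center D) (hderived : simply_connected_derived D)
    (u : units (lf_int F))
    (hu : forall a : units (lf_res F),
       exists m : nat, a = (units_map (lf_red F) u ^+ m)%g)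
    (mu : 'cV[int]_n) (hdom : dominant D mu) (hmin : minuscule D mu)
    (w : eaff n) (hw : admissible D R mu w)
    (J : {fset 'rV[int]_n}) (hJ : root_subsystem D J)
    (s : torus n (ur_res Fr)) (gamma : 'cV[int]_n)
    (hgamma : forall chi : depthZeroChar n F R,
       dual_char gamma (kappa_of u chi) = dz_res chi (torus_norm s)) :
  (~ critical_group D w J (torus_norm s) ->
     \sum_(kappa \in S_dz R D u w J) (uval (dual_char gamma kappa))^-1 = 0) /\
  (critical_group D w J (torus_norm s) ->
     \sum_(kappa \in S_dz R D u w J) (uval (dual_char gamma kappa))^-1 =
       (#|` fset_set (S_dz R D u w J)|)%:R).
Proof.
set S := S_dz R D u w J; set g := units_map (lf_red F) u in hu.
have uw : w.2 \in unitmx by case: hw => /weyl_unitmx.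
(* The exact order N of [g] is extracted from g^(q-1) = 1, obtained by cancelling [g] in g^q = g. *)
have [N gN _] : {N | N.-primitive_root (uval g) & (N %| #|lf_res F|.-1)%N}.
  apply: prim_order_exists; first by rewrite -subn1 subn_gt0 finNzRing_gt1.
  apply: (mulfI (_ : uval g != 0)); first by rewrite -unitfE uvalP.
  by rewrite -exprS mulr1 prednK ?expf_card // ltnW // finNzRing_gt1.
have [dlog dlogK] := choice hu.
pose m : 'cV[int]_n := \col_i (dlog (torus_norm s i))%:Z.
have Dm : torus_norm s = cochar m g.
  by apply/ffunP => i; rewrite [RHS]ffunE mxE uexpz_nat -dlogK.
(* As characters [gamma] and [m] may differ, but at kappa_chi both equal chi(N_r(s)). *)
have gammaE kappa : S kappa -> dual_char gamma kappa = dual_char m kappa.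
  by case=> _ [chi ->]; rewrite hgamma Dm dz_resE.
have critE := critical_groupP R gN hu D J uw m.
split=> [|/[!Dm]/critE S1]; last first.
  rewrite (eq_fsbigr (fun=> 1)) => [|kappa /set_mem kS]; last first.
    by rewrite gammaE // S1 //= invr1.
  rewrite fsbig_finite; last exact: S_dz_finite.
  by rewrite big_const_seq count_predT iter_addr_0.
rewrite Dm critE => /existsNP[kappa0 /not_implyP[S0 /eqP m0]].
pose c := (uval (dual_char m kappa0))^-1.
have c1 : c != 1.
  by apply: contra_neq m0 => /eqP; rewrite invr_eq1 => /eqP m1; apply/val_inj.
(* Multiplication by [kappa0] permutes the group [S], so reindexing yields Sigma = c Sigma with c
   different from 1. *)
have shift : set_bij S S (fun kappa => kappa0 * kappa)%g.
  split=> [kappa kS|kappa kappa' _ _ /mulgI //|kappa kS].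
    exact: (S_dzM gN hu uw).
  exists (kappa0^-1 * kappa)%g; last by rewrite mulVKg.
  exact/(S_dzM gN hu uw)/kS/(S_dzV gN hu uw).
set Sigma := \sum_(_ \in _) _.
have eq_Sigma : Sigma = c * Sigma.
  rewrite {1}/Sigma (reindex_fsbig _ _ _ _ shift) mulr_fsumr.
  apply: eq_fsbigr => kappa /set_mem kS.
  rewrite !gammaE //; last exact: (S_dzM gN hu uw).
  by rewrite dual_charM /= invfM.
apply/eqP; move/eqP: eq_Sigma; rewrite -{1}[Sigma]mul1r -subr_eq0 -mulrBl.
by rewrite mulf_eq0 subr_eq0 eq_sym (negPf c1).
Qed.
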